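(* If the probability matrix $\widetilde Q$ has full row rank and the cross-entropy loss is used, then the minimiser $h^*_{\mathrm{TL}}=\arg\min_h\mathcal{R}_{\mathrm{TL}}(h)$ recovers the true minimiser $h^*=\arg\min_h\mathcal{R}(h)$, i.e. $h^*_{\mathrm{TL}}=h^*$.
   Context: Notation: $[n]=\{0,1,\dots,n-1\}$. $\mathcal{X}\subseteq\mathbb{R}^d$ is the input space, $\mathcal{Y}=[c]$ the label space with $c$ classes, $m$ the length of input sequences, and $\mathcal{T}$ a finite set of target concepts, indexed by $\{0,\dots,|\mathcal{T}|-1\}$. An instance $x\in\mathcal{X}$ comes with a true label $y\in\mathcal{Y}$, a location $\iota\in[m]$ (its position in the sequence it belongs to) and the target concept $\tau\in\mathcal{T}$ of that sequence. With $\widetilde c=m\cdot|\mathcal{T}|$, the pair $(\iota,\tau)=(k,t)$ is encoded as the synthetic label $\widetilde y=o=tm+k\in[\widetilde c]$. The distributions of $(x,y)$ and $(x,\widetilde y)$ are denoted $p(x,y)$ and $p(x,\widetilde y)$. Probability matrix: $\widetilde Q\in\mathbb{R}^{c\times\widetilde c}$ with $\widetilde Q_{jo}=p(\widetilde y=o\mid y=j)$, i.e. $p(\iota=k,\tau=t\mid y=j)$ for $o=tm+k$. It is assumed that $\widetilde y$ is independent of $x$ given $y$, so that for all $o\in[\widetilde c]$ $$p(\widetilde y=o\mid x)=\sum_{j=0}^{c-1}\widetilde Q_{jo}\,p(y=j\mid x).$$ Classifiers: $h$ ranges over maps $\mathcal{X}\to\mathbb{R}^c$. Put $g(x)=\operatorname{softmax}(h(x))$,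 i.e. $g_j(x)=\exp(h_j(x))/\sum_{i=0}^{c-1}\exp(h_i(x))$, and $\widetilde q(x)=\widetilde Q^\top g(x)$. Risks with cross-entropy loss: $$\mathcal{R}(h)=\mathbb{E}_{p(x,y)}\,\ell(h(x),y)=\mathbb{E}_{p(x,y)}\left[-\log g_y(x)\right],\qquad \mathcal{R}_{\mathrm{TL}}(h)=\mathbb{E}_{p(x,\widetilde y)}\,\ell(\widetilde q(x),\widetilde y)=\mathbb{E}_{p(x,\widetilde y)}\left[-\log\widetilde q_{\widetilde y}(x)\right].$$ *)

(* Defs.v *)
From HB Require Import structures.
From mathcomp Require Import all_boot all_order all_algebra.
From mathcomp Require Import all_classical all_reals all_analysis.

Set Implicit Arguments.
Unset Strict Implicit.
Unset Printing Implicit Defensive.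

Import Order.TTheory GRing.Theory Num.Theory.
Import numFieldNormedType.Exports.
Local Open Scope classical_set_scope.
Local Open Scope ring_scope.

Section classifiers.
Context {R : realType} {d c : nat} {X : set (d.-tuple R)}.
Implicit Types h : X -> 'cV[R]_c.

(* Measurability for the trace on X of the Borel sigma-algebra of R^d; X itself
   need not be a Borel set. *)
Definition measurable_classifier h : Prop :=
  forall (j : 'I_c) (B : set R), measurable B ->
    exists2 A : set (d.-tuple R), measurable A &
      [set u : X | B (h u j ord0)] = [set u : X | A (set_val u)].

Definition argmin (risk : (X -> 'cV[R]_c) -> \bar R) :
    set (X -> 'cV[R]_c) :=
  [set h | measurable_classifier h /\
    forall h', measurable_classifier h' -> (risk h <= risk h')%E].

End classifiers.

Definition softmax {R : realType} {c : nat} (v : 'cV[R]_c) : 'cV[R]_c :=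
  \col_j (expR (v j ord0) / \sum_(i < c) expR (v i ord0)).

(* The extended logarithm makes the loss +oo, not the junk value of [ln 0], when
   the label has score 0. *)
Definition cross_entropy {R : realType} {k : nat} (q : 'cV[R]_k) (i : 'I_k) :
    \bar R :=
  (- lne (q i ord0)%:E)%E.

Section synthetic_label.
Context {m : nat} {T : finType}.

Lemma synthetic_subproof (k : 'I_m) (t : T) : (enum_rank t * m + k < m * #|T|)%N.
Proof.
apply: (@leq_trans ((enum_rank t).+1 * m)%N).
  by rewrite mulSn addnC ltn_add2r.
by rewrite [leqRHS]mulnC leq_mul2r ltn_ord orbT.
Qed.

Definition synthetic (k : 'I_m) (t : T) : 'I_(m * #|T|) :=
  Ordinal (synthetic_subproof k t).

End synthetic_label.

Section random_instance.
Context {R : realType} {dO : measure_display} {Omega : measurableType dO}.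
Variable P : probability Omega R.

Definition discrete_rv {F : finType} (Z : Omega -> F) : Prop :=
  forall a, measurable (Z @^-1` [set a]).

(* Equal to 0 when [P B = 0]. *)
Definition cond_prob (A B : set Omega) : R := fine (P (A `&` B)) / fine (P B).

(* A class [j] of probability 0 yields a null row, so that full row rank entails
   that every conditional probability in the matrix is a genuine one. *)
Definition prob_matrix {c k : nat} (y : Omega -> 'I_c) (z : Omega -> 'I_k) :
    'M[R]_(c, k) :=
  \matrix_(j, o) cond_prob (z @^-1` [set o]) (y @^-1` [set j]).

Definition cond_indep_given {d : nat} {X : set (d.-tuple R)} {c k : nat}
    (z : Omega -> 'I_k) (x : Omega -> X) (y : Omega -> 'I_c) : Prop :=
  forall (A : set (d.-tuple R)) (o : 'I_k) (j : 'I_c), measurable A ->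
    let Ax := [set w | A (set_val (x w))] in
    let Bz := z @^-1` [set o] in
    let Cy := y @^-1` [set j] in
    cond_prob (Ax `&` Bz) Cy = cond_prob Ax Cy * cond_prob Bz Cy.

Definition risk {d : nat} {X : set (d.-tuple R)} {c : nat}
    (x : Omega -> X) (y : Omega -> 'I_c) (h : X -> 'cV[R]_c) : \bar R :=
  (\int[P]_w cross_entropy (softmax (h (x w))) (y w))%E.

Definition risk_TL {d : nat} {X : set (d.-tuple R)} {c k : nat}
    (Q : 'M[R]_(c, k)) (x : Omega -> X) (z : Omega -> 'I_k)
    (h : X -> 'cV[R]_c) : \bar R :=
  (\int[P]_w cross_entropy (Q^T *m softmax (h (x w))) (z w))%E.

End random_instance.

(* Main.v *)
(* Let f(x) be the posterior distribution of the label y given x, obtained as a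
   Radon-Nikodym density with respect to the law of x. By conditional
   independence the posterior of the synthetic label is Q^T f, so the risk of h
   is the mean cross entropy between Q^T f and Q^T softmax(h), and the ordinary
   risk is the case Q = 1. Gibbs' inequality bounds it below by the mean entropy
   of Q^T f, with equality iff Q^T softmax(h) = Q^T f almost surely, i.e., iff
   softmax(h) = f almost surely when Q has full row rank. The bound is the
   infimum even when f has zero entries and it is not attained. Hence both risks
   have the same set of minimisers, { h | softmax(h) = f almost surely }. *)
Require Import Defs.
From HB Require Import structures.
From mathcomp Require Import all_boot all_order all_algebra.
From mathcomp Require Import all_classical all_reals all_analysis.
From mathcomp Require Import measurable_realfun ring lra.
Import Order.TTheory GRing.Theory Num.Theory.
Import numFieldNormedType.Exports.
Local Open Scope classical_set_scope.
Local Open Scope ring_scope.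

(** * Gibbs' inequality and cross entropy for finite vectors *)

(** For [a > 0] this is [1 + t <= expR t] at [t = ln (b / a)], scaled by [a]; equality forces
    [t = 0]. The last hypothesis excludes the case [a > 0], [b = 0], where the default [ln 0 = 0]
    would stand for minus infinity. *)
Lemma gibbs_term {R : realType} (a b : R) :
  0 <= a -> 0 <= b -> (b = 0 -> a = 0) ->
  a - b <= a * ln a - a * ln b ?= iff (a == b).
Proof.
move=> a0 b0 ba; move: (a0); rewrite le_eqVlt => /predU1P[<-|{}a0].
  rewrite !mul0r subrr sub0r; split; first by rewrite oppr_le0.
  by rewrite oppr_eq0 eq_sym.
have {}b0 : 0 < b.
  rewrite lt_neqAle b0 andbT eq_sym; apply/eqP => /ba ae.
  by rewrite ae ltxx in a0.
have -> : a * ln a - a * ln b = a - a * (1 + ln (b / a)).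
  by rewrite ln_div ?posrE//; ring.
have bE : b = a * expR (ln (b / a)).
  by rewrite lnK ?posrE ?divr_gt0// mulrC divfK// gt_eqF.
have [->|ab] := eqVneq a b.
  by rewrite divff ?gt_eqF// ln1 addr0 mulr1; exact/leif_refl.
apply/leifP; rewrite [ltLHS](_ : _ = a - a * expR (ln (b / a))); last first.
  by rewrite -bE.
rewrite ltrD2l ltrN2 ltr_pM2l// expR_gt1Dx//.
rewrite ln_eq0 ?divr_gt0//; apply: contra ab => /eqP abE.
by rewrite eq_sym -[b](divfK (lt0r_neq0 a0)) abE mul1r.
Qed.

(** Mean of the loss of [b] under the weights [a], as a real number: with [ln 0 = 0] it is the true
    mean only if [a] vanishes wherever [b] does. [xent a a] is the Shannon entropy. *)
Definition xent {R : realType} {k : nat} (a b : 'cV[R]_k) : R :=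
  \sum_(o < k) a o ord0 * - ln (b o ord0).

(** Summing [gibbs_term] over the coordinates, the linear terms cancel because the total masses
    agree. *)
Lemma gibbs {R : realType} {k : nat} (a b : 'cV[R]_k) :
  (forall o, 0 <= a o ord0) -> (forall o, 0 <= b o ord0) ->
  (forall o, b o ord0 = 0 -> a o ord0 = 0) ->
  \sum_(o < k) a o ord0 = \sum_(o < k) b o ord0 ->
  xent a a <= xent a b ?= iff (a == b).
Proof.
move=> a0 b0 ba sab.
have := leif_sum (fun o (_ : true) => gibbs_term _ _ (a0 o) (b0 o) (ba o)).
rewrite !sumrB sab subrr => H.
have -> : xent a a = xent a a + 0 by rewrite addr0.
have -> : xent a b = xent a a +
    (\sum_o a o ord0 * ln (a o ord0) - \sum_o a o ord0 * ln (b o ord0)).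
  by rewrite addrC -sumrB /xent -big_split; apply: eq_bigr => o _ /=; ring.
have -> : (a == b) = [forall (o | true), a o ord0 == b o ord0].
  apply/eqP/forallP => [-> o //|ab]; first exact: eqxx.
  by apply/matrixP => o i; rewrite (ord1 i); exact/eqP/(ab o).
case: H => h1 h2; split; first by rewrite lerD2l.
by rewrite -h2 -subr_eq0 opprD addrACA subrr add0r subr_eq0.
Qed.

(** Where [b] vanishes the loss is [+oo], but its weight is 0 and [+oo * 0 = 0]. *)
Lemma sum_cross_entropy {R : realType} {k : nat} (a b : 'cV[R]_k) :
  (forall o, 0 <= b o ord0) -> (forall o, b o ord0 = 0 -> a o ord0 = 0) ->
  (\sum_(o < k) cross_entropy b o * (a o ord0)%:E = (xent a b)%:E)%E.
Proof.
move=> b0 ba; rewrite /xent -sumEFin; apply: eq_bigr => o _.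
rewrite /cross_entropy muleC; have [bo|bo] := eqVneq (b o ord0) 0.
  by rewrite (ba _ bo) mul0e mul0r.
by rewrite lne_EFin// lt_neqAle eq_sym bo b0.
Qed.

Lemma cross_entropy_ge0 {R : realType} {k : nat} (b : 'cV[R]_k) (o : 'I_k) :
  b o ord0 <= 1 -> (0 <= cross_entropy b o)%E.
Proof. by move=> b1; rewrite /cross_entropy oppe_ge0 lne_le0 lee_fin. Qed.

Lemma xent_self_ge0 {R : realType} {k : nat} (a : 'cV[R]_k) :
  (forall o, 0 <= a o ord0) -> (forall o, a o ord0 <= 1) -> 0 <= xent a a.
Proof.
by move=> a0 a1; apply: sumr_ge0 => o _; rewrite mulr_ge0// oppr_ge0 ln_le0.
Qed.

(** [gibbs_term] at [b = 1] bounds each term by [1 - a], hence by 1. This crude bound serves to make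
    the mean entropy finite. *)
Lemma xent_self_le {R : realType} {k : nat} (a : 'cV[R]_k) :
  (forall o, 0 <= a o ord0) -> xent a a <= k%:R.
Proof.
move=> a0; rewrite /xent -[k in leRHS]card_ord -sumr_const; apply: ler_sum => o _.
have [+ _] : a o ord0 - 1 <= a o ord0 * ln (a o ord0) - a o ord0 * ln 1
    ?= iff (a o ord0 == 1).
  by apply: gibbs_term => // /eqP; rewrite oner_eq0.
rewrite ln1 mulr0 subr0 mulrN; have := a0 o; lra.
Qed.

(** * Elementary properties of softmax *)

Lemma softmax_gt0 {R : realType} {c : nat} (v : 'cV[R]_c) (j : 'I_c) :
  0 < softmax v j ord0.
Proof.
rewrite mxE divr_gt0 ?expR_gt0// (bigD1 j)//= ltr_pwDl ?expR_gt0//.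
by apply: sumr_ge0 => i _; exact: expR_ge0.
Qed.

Lemma softmax_sum {R : realType} {c : nat} (v : 'cV[R]_c) (j0 : 'I_c) :
  \sum_(j < c) softmax v j ord0 = 1.
Proof.
under eq_bigr do rewrite mxE.
rewrite -mulr_suml divff// gt_eqF// (bigD1 j0)//= ltr_pwDl ?expR_gt0//.
by apply: sumr_ge0 => i _; exact: expR_ge0.
Qed.

Lemma softmax_ln {R : realType} {c : nat} (p : 'cV[R]_c) :
  (forall j, 0 < p j ord0) -> \sum_(j < c) p j ord0 = 1 ->
  softmax (\col_j ln (p j ord0)) = p.
Proof.
move=> p0 p1; apply/colP => j; rewrite mxE.
under eq_bigr do rewrite mxE lnK ?posrE//.
by rewrite p1 divr1 mxE lnK ?posrE.
Qed.

(** * Joint laws and their densities *)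

Section joint_law.
Context {d d' : measure_display} {Omega : measurableType d} {X : measurableType d'}
  {R : realType}.
Variables (P : probability Omega R) (x : {mfun Omega >-> X}).

(** The density of this finite measure with respect to the law of [x] is the conditional probability
    of [B] given [x]. The measurability proof is an argument so that the measure instance can be
    attached to the term. *)
Definition joint_law (B : set Omega) of measurable B :=
  fun A : set X => P (x @^-1` A `&` B).

Variables (B : set Omega) (mB : measurable B).

Let joint_law0 : joint_law _ mB set0 = 0%E.
Proof. by rewrite /joint_law preimage_set0 set0I measure0. Qed.

Let joint_law_ge0 A : (0 <= joint_law _ mB A)%E.
Proof. exact: measure_ge0. Qed.

Let joint_law_sigma_additive : semi_sigma_additive (joint_law _ mB).
Proof.
exact: (@measure_semi_sigma_additive _ _ _ (pushforward (mrestr P mB) x)).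
Qed.

HB.instance Definition _ := isMeasure.Build _ _ _ (joint_law _ mB)
  joint_law0 joint_law_ge0 joint_law_sigma_additive.

Let joint_law_fin : fin_num_fun (joint_law _ mB).
Proof.
move=> A mA; rewrite /joint_law fin_num_measure//; apply: measurableI => //.
exact: measurable_funPTI.
Qed.

HB.instance Definition _ := Measure_isFinite.Build _ _ _
  (joint_law _ mB) joint_law_fin.

Lemma joint_law_dominates : joint_law _ mB `<< distribution P x.
Proof.
apply/null_content_dominatesP => A mA A0; apply/eqP.
rewrite -measure_le0 -[leRHS]A0 /joint_law; apply: le_measure; rewrite ?inE//.
- by apply: measurableI => //; exact: measurable_funPTI.
- exact: measurable_funPTI.
Qed.

Lemma ge0_integral_joint_law (phi : X -> \bar R) :
  measurable_fun setT phi -> (forall u, 0 <= phi u)%E ->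
  (\int[joint_law _ mB]_u phi u = \int[P]_(w in B) phi (x w))%E.
Proof.
move=> mphi phi0.
have mphix : measurable_fun setT (phi \o x) by exact: measurableT_comp.
have -> : (\int[joint_law _ mB]_u phi u = \int[mrestr P mB]_w phi (x w))%E.
  exact: (@ge0_integral_pushforward _ _ _ _ _ x _ (mrestr P mB) setT).
rewrite -(setUv B) ge0_integral_setU//; last 3 first.
- exact: measurableC.
- by rewrite setUv.
- exact/disj_set2P/setICr.
(* The restricted measure gives the complement of [B] mass 0. *)
rewrite (@null_set_integral _ _ _ (mrestr P mB) (~` B)) ?adde0//; last 3 first.
- exact: measurableC.
- exact: measurable_funTS.
- by rewrite /= /mrestr setICl measure0.
by apply: eq_measure_integral => A mA AB; rewrite /= /mrestr setIidl.
Qed.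

(** [f] has the same integral as the Radon-Nikodym derivative over every measurable set, so the two
    agree almost everywhere and [f] may replace it in the change of variables. *)
Lemma integral_density (f : X -> R) (phi : X -> \bar R) :
  measurable_fun setT f -> (forall u, 0 <= f u) ->
  (forall A, measurable A ->
    P (x @^-1` A `&` B) = \int[distribution P x]_(u in A) (f u)%:E)%E ->
  measurable_fun setT phi -> (forall u, 0 <= phi u)%E ->
  (\int[P]_(w in B) phi (x w) = \int[distribution P x]_u (phi u * (f u)%:E))%E.
Proof.
move=> mf f0 fE mphi phi0; rewrite -ge0_integral_joint_law//.
pose g := Radon_Nikodym_SigmaFinite.f (joint_law _ mB) (distribution P x).
have dom := joint_law_dominates.
have ig := Radon_Nikodym_SigmaFinite.f_integrable dom.
have g0 := Radon_Nikodym_SigmaFinite.f_ge0 dom.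
have mg := measurable_int _ ig.
have mEf : measurable_fun setT (EFin \o f) by exact/measurable_EFinP.
rewrite -(Radon_Nikodym_SigmaFinite.change_of_variables dom phi0)//.
apply: ge0_ae_eq_integral => //.
- exact: emeasurable_funM.
- exact: emeasurable_funM.
- by move=> u _; rewrite mule_ge0.
- by move=> u _; rewrite mule_ge0// lee_fin.
apply: ae_eqe_mul2l; apply: integral_ae_eq => // A _ mA.
by rewrite -Radon_Nikodym_SigmaFinite.f_integral// -fE.
Qed.

End joint_law.

(** * Splitting measures and integrals along a finite-valued variable *)

Section discrete_partition.
Context {d : measure_display} {Omega : measurableType d} {R : realType}
  {k : nat}.
Variables (P : {measure set Omega -> \bar R}) (z : Omega -> 'I_k).
Hypothesis mz : discrete_rv z.

Let levels_cover : \big[setU/set0]_(o < k) (z @^-1` [set o]) = setT.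
Proof.
apply/seteqP; split=> // w _; rewrite -bigcup_seq.
by exists (z w) => //=; rewrite mem_index_enum.
Qed.

Let levels_disjoint : trivIset setT (fun o => z @^-1` [set o]).
Proof. by move=> i j _ _ [w [/= -> ->]]. Qed.

Lemma measure_partition_discrete (A : set Omega) : measurable A ->
  P A = (\sum_(o < k) P (A `&` z @^-1` [set o]))%E.
Proof.
move=> mA; rewrite -measure_bigsetU_ord//=.
- by rewrite -big_distrr/= levels_cover setIT.
- by move=> o; apply: measurableI.
- exact: trivIset_setIl.
Qed.

Lemma ge0_integral_partition_discrete (F : Omega -> \bar R) :
  measurable_fun setT F -> (forall w, 0 <= F w)%E ->
  (\int[P]_w F w = \sum_(o < k) \int[P]_(w in z @^-1` [set o]) F w)%E.
Proof.
move=> mF F0; rewrite -levels_cover ge0_integral_bigsetU//.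
- exact: index_enum_uniq.
- by apply: sub_trivIset levels_disjoint.
- exact: measurable_funTS.
Qed.

End discrete_partition.

(** * Posterior distribution of a label *)

(** A regular conditional distribution of [y] given [x]. It is a probability vector at every point,
    so that Gibbs' inequality can be applied pointwise. *)
Definition is_posterior {d d' : measure_display} {Omega : measurableType d}
    {X : measurableType d'} {R : realType} {c : nat} (P : probability Omega R)
    (x : {mfun Omega >-> X}) (y : Omega -> 'I_c) (f : X -> 'cV[R]_c) : Prop :=
  [/\ forall j, measurable_fun setT (fun u => f u j ord0),
      forall u j, 0 <= f u j ord0,
      forall u, \sum_(j < c) f u j ord0 = 1 &
      forall j (A : set X), measurable A ->
        P (x @^-1` A `&` y @^-1` [set j]) =
        (\int[distribution P x]_(u in A) (f u j ord0)%:E)%E].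

Lemma posterior_exists {d d' : measure_display} {Omega : measurableType d}
    {X : measurableType d'} {R : realType} {c : nat} (P : probability Omega R)
    (x : {mfun Omega >-> X}) (y : Omega -> 'I_c) :
  discrete_rv y -> exists f, is_posterior P x y f.
Proof.
move=> my; set mu := distribution P x.
have c0 : (0 < c)%N by apply: leq_ltn_trans (ltn_ord (y point)).
pose nu j := joint_law P x _ (my j).
have dom j : nu j `<< mu by exact: joint_law_dominates.
pose g j := Radon_Nikodym_SigmaFinite.f (nu j) mu.
have g0 j u : (0 <= g j u)%E by exact: (Radon_Nikodym_SigmaFinite.f_ge0 (dom j)).
have gfin j u : g j u \is a fin_num.
  exact: (Radon_Nikodym_SigmaFinite.f_fin_num (dom j)).
have ig j : mu.-integrable setT (g j).
  exact: (Radon_Nikodym_SigmaFinite.f_integrable (dom j)).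
have mg j : measurable_fun setT (g j) by exact: measurable_int (ig j).
have gE j A : measurable A -> nu j A = (\int[mu]_(u in A) g j u)%E.
  exact: (Radon_Nikodym_SigmaFinite.f_integral (dom j)).
pose S u := (\sum_(j < c) g j u)%E.
have mS : measurable_fun setT S by exact: emeasurable_sum.
(* Over each [A] both sides integrate to the law of [x] at [A], because the level sets of [y]
   partition [Omega]. *)
have S1 : ae_eq mu setT S (cst 1%E).
  apply: integral_ae_eq => //; first exact: integrable_sum.
  move=> A _ mA; rewrite integral_cst// mul1e ge0_integral_sum//.
  - under eq_bigr do rewrite -gE//.
    rewrite /mu /distribution /pushforward /= [RHS](measure_partition_discrete P _ my)//.
    exact: measurable_funPTI.
  - by move=> j; exact: measurable_funTS.
(* The densities sum to 1 only almost everywhere; on the exceptional null set the uniform vector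
   replaces them. *)
pose f u : 'cV[R]_c := \col_j (if S u == 1%E then fine (g j u) else c%:R^-1).
have mS1 : measurable_fun setT (fun u => S u == 1%E).
  apply: (measurable_fun_bool true); rewrite setTI.
  rewrite (_ : _ @^-1` _ = S @^-1` [set 1%E]); last first.
    by apply/seteqP; split=> u /= /eqP.
  by rewrite -[_ @^-1` _]setTI; exact: mS.
have mf j : measurable_fun setT (fun u => f u j ord0).
  under eq_fun do rewrite mxE.
  by apply: measurable_fun_ifT => //; exact: measurableT_comp.
exists f; split=> //.
- by move=> u j; rewrite mxE; case: ifP => _; rewrite ?fine_ge0// invr_ge0.
- move=> u; under eq_bigr do rewrite mxE.
  have [Su|_] := eqVneq (S u) 1%E.
    apply: EFin_inj; rewrite -sumEFin -[RHS]Su.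
    by apply: eq_bigr => j _; rewrite fineK.
  by rewrite sumr_const card_ord -[_^-1 *+ c]mulr_natr mulVf// pnatr_eq0 -lt0n.
- move=> j A mA; transitivity (nu j A) => //; rewrite gE//.
  apply: ge0_ae_eq_integral => //.
  + exact: measurable_funTS.
  + by apply/measurable_EFinP; exact: measurable_funTS.
  + move=> u _; rewrite lee_fin mxE.
    by case: ifP => _; rewrite ?fine_ge0// invr_ge0.
  + apply: (ae_eq_subset (@subsetT _ A)); apply: filterS S1 => u /(_ I) Su _.
    by rewrite mxE Su eqxx fineK.
Qed.

(** * Measurability of vector-valued maps and losses *)

Definition measurable_cols {R : realType} {d : measure_display}
    {X : measurableType d} {k : nat} (v : X -> 'cV[R]_k) : Prop :=
  forall i, measurable_fun setT (fun u => v u i ord0).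

Section measurable_cols_theory.
Context {R : realType} {d : measure_display} {X : measurableType d} {k : nat}.
Implicit Types v : X -> 'cV[R]_k.

Lemma measurable_cols_mulmx {l : nat} (A : 'M[R]_(l, k)) v :
  measurable_cols v -> measurable_cols (fun u => A *m v u).
Proof.
move=> mv i; under eq_fun do rewrite mxE.
by apply: measurable_sum => j; exact: measurable_funM.
Qed.

Lemma measurable_cols_softmax v :
  measurable_cols v -> measurable_cols (fun u => softmax (v u)).
Proof.
move=> mv i.
have mE j : measurable_fun setT (fun u => expR (v u j ord0)).
  by apply: measurableT_comp => //; exact: mv.
(* Writing the quotient as the exponential of a difference reduces the claim to measurability of
   [expR] and [ln]. *)
have -> : (fun u => softmax (v u) i ord0) =
    (fun u => expR (v u i ord0 - ln (\sum_(j < k) expR (v u j ord0)))).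
  apply/funext => u; rewrite mxE expRB lnK// posrE (bigD1 i)//=.
  by rewrite ltr_pwDl ?expR_gt0// sumr_ge0// => j _; exact: expR_ge0.
apply: measurableT_comp => //; apply: measurable_funB; first exact: mv.
by apply: measurableT_comp => //; exact: measurable_sum.
Qed.

Lemma measurable_xent v w : measurable_cols v -> measurable_cols w ->
  measurable_fun setT (fun u => xent (v u) (w u)).
Proof.
move=> mv mw; apply: measurable_sum => o; apply: measurable_funM; first exact: mv.
by apply: measurableT_comp => //; apply: measurableT_comp => //; exact: mw.
Qed.

Lemma measurable_cross_entropy v o :
  measurable_cols v -> measurable_fun setT (fun u => cross_entropy (v u) o).
Proof.
move=> mv; apply: measurableT_comp => //=.
apply: measurable_fun_ifT => //; first by apply: measurable_fun_ler => //; exact: mv.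
by apply/measurable_EFinP; apply: measurableT_comp => //; exact: mv.
Qed.

End measurable_cols_theory.

Lemma measurable_fun_discrete {d d' : measure_display} {Omega : measurableType d}
    {Y : measurableType d'} {k : nat} (z : Omega -> 'I_k) (F : 'I_k -> Omega -> Y) :
  discrete_rv z -> (forall o, measurable_fun setT (F o)) ->
  measurable_fun setT (fun w => F (z w) w).
Proof.
move=> mz mF _ B mB; rewrite setTI.
have -> : (fun w => F (z w) w) @^-1` B =
    \big[setU/set0]_(o < k) (z @^-1` [set o] `&` F o @^-1` B).
  rewrite -bigcup_seq; apply/seteqP; split=> [w Bw|w [i _ [/= <- ?]]] //.
  by exists (z w) => //=; rewrite mem_index_enum.
apply: bigsetU_measurable => o _; apply: measurableI; first exact: mz.
by rewrite -[_ @^-1` _]setTI; exact: mF.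
Qed.

(** * Probability vectors and stochastic matrices *)

Definition prob_vec {R : realType} {k : nat} (v : 'cV[R]_k) : Prop :=
  (forall i, 0 <= v i ord0) /\ \sum_(i < k) v i ord0 = 1.

Lemma prob_vec_le1 {R : realType} {k : nat} (v : 'cV[R]_k) i :
  prob_vec v -> v i ord0 <= 1.
Proof.
by case=> v0 <-; rewrite (bigD1 i)//= lerDl sumr_ge0.
Qed.

Lemma softmax_prob_vec {R : realType} {c : nat} (v : 'cV[R]_c) (j : 'I_c) :
  prob_vec (softmax v).
Proof.
by split=> [i|]; [exact/ltW/softmax_gt0|exact: softmax_sum].
Qed.

(** Wherever [a] is positive, [- ln b] exceeds [- ln a] by at most [delta]; averaging with weights
    of sum 1 keeps the bound. *)
Lemma xent_le_scale {R : realType} {k : nat} (a b : 'cV[R]_k) (delta : R) :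
  prob_vec a -> (forall o, expR (- delta) * a o ord0 <= b o ord0) ->
  xent a b <= xent a a + delta.
Proof.
move=> [a0 a1] ab.
rewrite -[delta]mul1r -a1 mulr_suml -big_split; apply: ler_sum => o _ /=.
rewrite -mulrDr; have := a0 o; rewrite le_eqVlt => /predU1P[<-|ao].
  by rewrite !mul0r.
have eao : 0 < expR (- delta) * a o ord0 by rewrite mulr_gt0 ?expR_gt0.
rewrite ler_pM2l// lerNl opprD opprK -(expRK (- delta)) addrC.
by rewrite -lnM ?posrE ?expR_gt0// ler_ln ?posrE// (lt_le_trans eao).
Qed.

Section channel.
Context {R : realType} {c k : nat}.
Variable Q : 'M[R]_(c, k).
Hypotheses (Q0 : forall j o, 0 <= Q j o) (Q1 : forall j, \sum_(o < k) Q j o = 1).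

Lemma channel_prob_vec v : prob_vec v -> prob_vec (Q^T *m v).
Proof.
move=> [v0 v1]; split=> [i|].
  by rewrite mxE sumr_ge0// => j _; rewrite mxE mulr_ge0.
rewrite -v1; under eq_bigr do rewrite mxE.
rewrite exchange_big; apply: eq_bigr => j _ /=.
by under eq_bigr do rewrite mxE; rewrite -mulr_suml Q1 mul1r.
Qed.

(** A vanishing sum of nonnegative terms with positive factors [v j] forces the whole column [o] of
    [Q] to vanish. *)
Lemma channel_eq0 (v w : 'cV[R]_c) o : (forall j, 0 < v j ord0) ->
  (Q^T *m v) o ord0 = 0 -> (Q^T *m w) o ord0 = 0.
Proof.
move=> v0; rewrite mxE => /psumr_eq0P Qv.
rewrite mxE big1// => j _.
have /eqP : Q^T o j * v j ord0 = 0.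
  by apply: Qv => // i _; rewrite mxE mulr_ge0// ltW.
by rewrite mulf_eq0 (gt_eqF (v0 j)) orbF => /eqP ->; rewrite mul0r.
Qed.

(** Full row rank makes multiplication by [Q^T] injective, so equality of the images in Gibbs'
    inequality gives equality of [p] and [q]. *)
Lemma gibbs_channel (p q : 'cV[R]_c) : row_free Q ->
  prob_vec p -> prob_vec q -> (forall j, 0 < q j ord0) ->
  xent (Q^T *m p) (Q^T *m p) <= xent (Q^T *m p) (Q^T *m q) ?= iff (q == p).
Proof.
move=> Qfree pp pq q0.
have [p0 p1] := channel_prob_vec _ pp; have [qq0 q1] := channel_prob_vec _ pq.
have -> : (q == p) = (Q^T *m p == Q^T *m q).
  apply/eqP/eqP => [->//|/(congr1 trmx)]; rewrite !trmx_mul trmxK.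
  by move=> /(row_free_inj Qfree)/trmx_inj.
apply: gibbs => // [i|]; last by rewrite p1.
exact: channel_eq0.
Qed.

End channel.

(** * Minimisers of the risk seen through a stochastic matrix of full row rank *)

Section channel_risk.
Context {d d' : measure_display} {Omega : measurableType d} {X : measurableType d'}
  {R : realType} {c k : nat}.
Variables (P : probability Omega R) (x : {mfun Omega >-> X}) (y : Omega -> 'I_c)
  (z : Omega -> 'I_k) (Q : 'M[R]_(c, k)) (f : X -> 'cV[R]_c).
Hypotheses (fP : is_posterior P x y f) (mz : discrete_rv z)
  (Q0 : forall j o, 0 <= Q j o) (Q1 : forall j, \sum_(o < k) Q j o = 1)
  (QP : forall o (A : set X), measurable A ->
    P (x @^-1` A `&` z @^-1` [set o]) =
    (\sum_(j < c) (Q j o)%:E * P (x @^-1` A `&` y @^-1` [set j]))%E)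
  (Qfree : row_free Q).
Implicit Types h : X -> 'cV[R]_c.

Local Notation mu := (distribution P x).
Local Notation channel_risk h :=
  (\int[P]_w cross_entropy (Q^T *m softmax (h (x w))) (z w))%E.

Let f_prob u : prob_vec (f u).
Proof. by case: fP. Qed.

Let mf : measurable_cols f.
Proof. by case: fP. Qed.

Let integral_mu_cst (r : R) : (\int[mu]_(_ in setT) r%:E = r%:E)%E.
Proof.
rewrite integral_cst// -[RHS]mule1; congr (_ * _)%E.
exact: (@probability_setT _ _ _ mu).
Qed.

Let j0 : 'I_c := y point.

Let xent0 h u : 0 <= xent (Q^T *m f u) (Q^T *m softmax (h u)).
Proof.
have [a0 a1] := channel_prob_vec _ Q0 Q1 _ (f_prob u).
apply: sumr_ge0 => o _; rewrite mulr_ge0// oppr_ge0 ln_le0//.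
exact/prob_vec_le1/channel_prob_vec/softmax_prob_vec.
Qed.

(** The posterior of [z] is [Q^T f]: the identities defining [f] are combined linearly with the
    weights [Q j o]. *)
Lemma channel_density o (A : set X) : measurable A ->
  P (x @^-1` A `&` z @^-1` [set o]) =
  (\int[mu]_(u in A) ((Q^T *m f u) o ord0)%:E)%E.
Proof.
move=> mA; case: fP => mfP f0 _ fE.
rewrite QP//; under eq_integral do rewrite mxE -sumEFin.
have mfA j : measurable_fun A (fun u => (f u j ord0)%:E).
  by apply/measurable_EFinP; exact: measurable_funTS.
rewrite ge0_integral_sum//.
- apply: eq_bigr => j _; rewrite fE// -ge0_integralZl_EFin//.
  + by apply: eq_integral => u _; rewrite mxE.
  + by move=> u _; rewrite lee_fin.
- move=> j; apply/measurable_EFinP/measurable_funM => //.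
  exact: measurable_funTS.
- by move=> j u _; rewrite lee_fin mxE mulr_ge0.
Qed.

(** On each level set of [z] the loss depends on [x] alone, so [channel_density] turns its integral
    into one over the law of [x]. Positivity of softmax ensures that [Q^T f] vanishes wherever the
    score does. *)
Lemma channel_riskE h : measurable_cols h ->
  channel_risk h = (\int[mu]_u (xent (Q^T *m f u) (Q^T *m softmax (h u)))%:E)%E.
Proof.
move=> mh; pose q u := Q^T *m softmax (h u).
have mq : measurable_cols q by apply/measurable_cols_mulmx/measurable_cols_softmax.
have ma : measurable_cols (fun u => Q^T *m f u) by exact: measurable_cols_mulmx.
have a0 u o : 0 <= (Q^T *m f u) o ord0.
  by have [] := channel_prob_vec _ Q0 Q1 _ (f_prob u).
have q_prob u : prob_vec (q u) by apply/channel_prob_vec/softmax_prob_vec.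
have ce0 u o : (0 <= cross_entropy (q u) o)%E.
  exact/cross_entropy_ge0/prob_vec_le1.
have mce o : measurable_fun setT (fun u => cross_entropy (q u) o).
  exact: measurable_cross_entropy.
pose F o w := cross_entropy (q (x w)) o.
have mF : measurable_fun setT (fun w => F (z w) w).
  apply: measurable_fun_discrete => // o.
  exact: (measurableT_comp (mce o)).
rewrite (ge0_integral_partition_discrete P _ mz _ mF); last by move=> w; exact: ce0.
transitivity (\sum_(o < k) \int[mu]_u
    (cross_entropy (q u) o * ((Q^T *m f u) o ord0)%:E))%E.
  apply: eq_bigr => o _.
  rewrite -(integral_density P x _ (mz o) _ (fun u => cross_entropy (q u) o))//.
    by apply: eq_integral => w; rewrite inE/= => <-.
  by move=> A mA; exact: channel_density.
rewrite -ge0_integral_sum//.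
- apply: eq_integral => u _; rewrite sum_cross_entropy// => [i|i].
    by case: (q_prob u).
  by apply: channel_eq0 => // j; exact: softmax_gt0.
- by move=> o; apply: emeasurable_funM => //; apply/measurable_EFinP; exact: ma.
- by move=> o u _; rewrite mule_ge0// lee_fin.
Qed.

Local Notation entropy_integral :=
  (\int[mu]_u (xent (Q^T *m f u) (Q^T *m f u))%:E)%E.

Let entropy0 u : 0 <= xent (Q^T *m f u) (Q^T *m f u).
Proof.
have aP := channel_prob_vec _ Q0 Q1 _ (f_prob u).
by apply: xent_self_ge0 => o; [case: aP|exact: prob_vec_le1].
Qed.

Let m_entropy : measurable_fun setT (fun u => xent (Q^T *m f u) (Q^T *m f u)).
Proof. by apply: measurable_xent; exact: measurable_cols_mulmx. Qed.

Lemma entropy_integral_lty : (entropy_integral < +oo)%E.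
Proof.
apply: (@le_lt_trans _ _ (\int[mu]_(_ in setT) k%:R%:E)%E); last first.
  by rewrite integral_mu_cst ltry.
apply: ge0_le_integral => //.
- by move=> u _; rewrite lee_fin.
- exact/measurable_EFinP.
- move=> u _; rewrite lee_fin xent_self_le// => o.
  by have [] := channel_prob_vec _ Q0 Q1 _ (f_prob u).
Qed.

Lemma entropy_integral_le_risk h :
  measurable_cols h -> (entropy_integral <= channel_risk h)%E.
Proof.
move=> mh; rewrite channel_riskE//; apply: ge0_le_integral => //.
- by move=> u _; rewrite lee_fin.
- by apply/measurable_EFinP.
- apply/measurable_EFinP/measurable_xent; first exact: measurable_cols_mulmx.
  exact/measurable_cols_mulmx/measurable_cols_softmax.
- move=> u _; rewrite lee_fin; apply: (gibbs_channel _ Q0 Q1) => //.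
  + exact: softmax_prob_vec.
  + by move=> j; exact: softmax_gt0.
Qed.

(* Mixing the posterior with the uniform distribution makes it the softmax of a
   finite score, even where some classes have posterior probability 0. *)
Lemma near_optimal_risk (delta : R) : 0 < delta -> exists2 h, measurable_cols h &
  (channel_risk h <= entropy_integral + delta%:E)%E.
Proof.
(* Keeping the fraction [expR (- delta)] of the posterior is what [xent_le_scale] needs for an
   excess of at most [delta]. *)
move=> delta0; pose e := expR (- delta).
have e0 : 0 < e by exact: expR_gt0.
have e1 : e < 1 by rewrite expR_lt1 oppr_lt0.
have c0 : (0 < c)%N by exact: leq_ltn_trans (ltn_ord j0).
have c0R : (0 : R) < c%:R by rewrite ltr0n.
pose p u : 'cV[R]_c := \col_j (e * f u j ord0 + (1 - e) / c%:R).
have pE u j : p u j ord0 = e * f u j ord0 + (1 - e) / c%:R by rewrite mxE.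
have r0 : 0 < (1 - e) / c%:R by rewrite divr_gt0// subr_gt0.
have fp u j : e * f u j ord0 <= p u j ord0 by rewrite pE lerDl ltW.
have p0 u j : 0 < p u j ord0.
  by rewrite pE ltr_wpDl// mulr_ge0//; [exact: ltW|case: (f_prob u)].
have p1 u : \sum_(j < c) p u j ord0 = 1.
  under eq_bigr do rewrite pE.
  rewrite big_split/= -mulr_sumr (f_prob u).2 sumr_const card_ord.
  by rewrite -[_ / _ *+ c]mulr_natr divfK ?gt_eqF//; ring.
pose h u : 'cV[R]_c := \col_j ln (p u j ord0).
have hE u : softmax (h u) = p u by exact: softmax_ln.
have mh : measurable_cols h.
  move=> j; under eq_fun do rewrite mxE pE.
  apply: measurableT_comp => //; apply: measurable_funD => //.
  by apply: measurable_funM => //; exact: mf.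
exists h => //.
rewrite channel_riskE//.
have -> : (entropy_integral + delta%:E =
    \int[mu]_u (xent (Q^T *m f u) (Q^T *m f u) + delta)%:E)%E.
  rewrite -[X in (_ + X)%E]integral_mu_cst -ge0_integralD//.
  - by move=> u _; rewrite lee_fin.
  - exact/measurable_EFinP.
  - by move=> u _; rewrite lee_fin ltW.
apply: ge0_le_integral => //.
- by move=> u _; rewrite lee_fin.
- apply/measurable_EFinP/measurable_xent; first exact: measurable_cols_mulmx.
  exact/measurable_cols_mulmx/measurable_cols_softmax.
- by apply/measurable_EFinP/measurable_funD.
- move=> u _; rewrite lee_fin xent_le_scale//; first exact: channel_prob_vec.
  (* The bound [e * f <= p] passes through [Q^T] because the entries of [Q] are nonnegative. *)
  move=> o; rewrite -/e hE !mxE mulr_sumr; apply: ler_sum => j _.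
  by rewrite mulrCA ler_wpM2l// mxE.
Qed.

(** The infimum of the risk is the mean entropy, so a minimiser makes the nonnegative gap [K - H]
    integrate to 0; the gap then vanishes almost everywhere, and the equality case of Gibbs applies.
    Conversely, equality almost everywhere attains the lower bound. *)
Lemma channel_risk_minimizerP h : measurable_cols h ->
  (forall h', measurable_cols h' -> (channel_risk h <= channel_risk h')%E) <->
  ae_eq mu setT (fun u => softmax (h u)) f.
Proof.
move=> mh.
pose H u := xent (Q^T *m f u) (Q^T *m f u).
pose K u := xent (Q^T *m f u) (Q^T *m softmax (h u)).
have mK : measurable_fun setT K.
  apply/measurable_xent; first exact: measurable_cols_mulmx.
  exact/measurable_cols_mulmx/measurable_cols_softmax.
have HK u : H u <= K u ?= iff (softmax (h u) == f u).
  apply: (gibbs_channel _ Q0 Q1) => //; first exact: softmax_prob_vec.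
  by move=> j; exact: softmax_gt0.
have mD : measurable_fun setT (fun u => K u - H u) by exact: measurable_funB.
split=> [hmin|hf].
- have hle : (channel_risk h <= entropy_integral)%E.
    apply/lee_addgt0Pr => e /near_optimal_risk[h' mh' h'e].
    exact: le_trans (hmin _ mh') h'e.
  have D0 : (\int[mu]_u `|(K u - H u)%:E| = 0)%E.
    under eq_integral do rewrite gee0_abs ?lee_fin ?subr_ge0 ?HK//.
    apply/eqP; rewrite eq_le integral_ge0 ?andbT; last first.
      by move=> u _; rewrite lee_fin subr_ge0 HK.
    (* The mean entropy is finite, so adding it to both sides gives an equivalent inequality. *)
    rewrite -(leeD2lE (x := entropy_integral)); last first.
      rewrite ge0_fin_numE ?entropy_integral_lty// integral_ge0// => u _.
      by rewrite lee_fin.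
    rewrite adde0 -ge0_integralD//; last 4 first.
    + by move=> u _; rewrite lee_fin; exact: entropy0.
    + exact/measurable_EFinP.
    + by move=> u _; rewrite lee_fin subr_ge0 HK.
    + exact/measurable_EFinP.
    apply: le_trans hle; rewrite channel_riskE//.
    rewrite le_eqVlt; apply/orP; left; apply/eqP/eq_integral => u _.
    by rewrite -EFinD addrC subrK.
  have := (ae_eq_integral_abs mu measurableT _).1 D0.
  move=> /(_ ((measurable_EFinP _ _).2 mD)).
  apply: filterS => u /(_ I) [] /eqP; rewrite subr_eq0 eq_sym (HK u).2 => /eqP + _.
  by [].
- move=> h' mh'; apply: le_trans (entropy_integral_le_risk _ mh').
  rewrite channel_riskE// le_eqVlt; apply/orP; left; apply/eqP.
  apply: ge0_ae_eq_integral => //; try exact/measurable_EFinP.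
  + by move=> u _; rewrite lee_fin; exact: xent0.
  + by move=> u _; rewrite lee_fin; exact: entropy0.
  + by apply: filterS hf => u /(_ I) -> _.
Qed.

End channel_risk.

(** * The probability matrix as a stochastic matrix *)

Section prob_matrix_theory.
Context {d : measure_display} {Omega : measurableType d} {R : realType}
  {c k : nat}.
Variables (P : probability Omega R) (y : Omega -> 'I_c) (z : Omega -> 'I_k).
Hypotheses (my : discrete_rv y) (mz : discrete_rv z).

Lemma prob_matrix_ge0 j o : 0 <= prob_matrix P y z j o.
Proof. by rewrite mxE divr_ge0// fine_ge0. Qed.

(** Division by 0 gives 0, so a null class would give a zero row, and the unit row vector at [j]
    would have the same image as 0. *)
Lemma row_free_class_neq0 j :
  row_free (prob_matrix P y z) -> fine (P (y @^-1` [set j])) != 0.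
Proof.
move=> Qfree; apply/eqP => Pj.
have : delta_mx ord0 j *m prob_matrix P y z = (0 : 'rV_c) *m prob_matrix P y z.
  rewrite -rowE mul0mx; apply/rowP => o.
  by rewrite !mxE /cond_prob Pj invr0 mulr0.
move=> /(row_free_inj Qfree)/rowP/(_ j); rewrite !mxE !eqxx => /eqP.
by rewrite oner_eq0.
Qed.

Lemma prob_matrix_row_sum j : fine (P (y @^-1` [set j])) != 0 ->
  \sum_(o < k) prob_matrix P y z j o = 1.
Proof.
move=> Pj; under eq_bigr do rewrite mxE /cond_prob setIC.
rewrite -mulr_suml sum_fine => [|i _]; last first.
  by apply: fin_num_measure; exact: measurableI.
by rewrite -(measure_partition_discrete P z mz)// divff.
Qed.

(** Total probability over the classes; in each class, conditional independence is multiplied by the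
    nonzero class probability. *)
Lemma prob_matrix_cond_indep {n : nat} {X : set (n.-tuple R)} (x : Omega -> X)
    o (A : set (n.-tuple R)) :
  measurable_fun setT (fun w => set_val (x w)) ->
  cond_indep_given P z x y ->
  (forall j, fine (P (y @^-1` [set j])) != 0) ->
  measurable A ->
  let Ax := [set w | A (set_val (x w))] in
  P (Ax `&` z @^-1` [set o]) =
  (\sum_(j < c) (prob_matrix P y z j o)%:E * P (Ax `&` y @^-1` [set j]))%E.
Proof.
move=> mx indep Py mA Ax.
have mAx : measurable Ax by rewrite -[Ax]setTI; exact: mx.
have fin B : measurable B -> P B \is a fin_num by exact: fin_num_measure.
rewrite (measure_partition_discrete P y my); last exact: measurableI.
apply: eq_bigr => j _.
rewrite -(fineK (fin (Ax `&` y @^-1` [set j]) _)); last exact: measurableI.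
rewrite -[LHS]fineK ?fin//; last by apply: measurableI => //; exact: measurableI.
rewrite -EFinM; congr EFin; rewrite mxE; have := indep A o j mA.
rewrite /= -/Ax /cond_prob => /(congr1 (fun r => r * fine (P (y @^-1` [set j])))).
rewrite divfK// => ->.
by rewrite mulrAC divfK// mulrC.
Qed.

End prob_matrix_theory.

Lemma discrete_rv_synthetic {d : measure_display} {Omega : measurableType d}
    {m : nat} {T : finType} (iota : Omega -> 'I_m) (tau : Omega -> T) :
  discrete_rv iota -> discrete_rv tau ->
  discrete_rv (fun w => synthetic (iota w) (tau w)).
Proof.
move=> miota mtau o.
have -> : (fun w => synthetic (iota w) (tau w)) @^-1` [set o] =
    \big[setU/set0]_(p : 'I_m * T | synthetic p.1 p.2 == o)
      (iota @^-1` [set p.1] `&` tau @^-1` [set p.2]).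
  rewrite -bigcup_seq_cond; apply/seteqP; split=> [w /= zw|w [p /= + [-> ->]]].
    by exists (iota w, tau w) => //=; rewrite mem_index_enum zw eqxx.
  by move=> /andP[_ /eqP].
by apply: bigsetU_measurable => p _; exact: measurableI.
Qed.

(** * The trace sigma-algebra on the input space *)

Section trace_space.
Context {R : realType} {n : nat} {X : set (n.-tuple R)}.

(* Measurable types are pointed, hence the parameter [p]. *)
Definition trace_pointed (p : X) : pointedType :=
  HB.pack (set_type X) (isPointed.Build _ p).

(** The sigma-algebra generated by the inclusion of [X]: its measurable sets are exactly the traces
    used in [measurable_classifier]. *)
Definition trace_space (p : X) : measurableType _ :=
  g_sigma_algebra_preimageType (set_val : trace_pointed p -> n.-tuple R).

Lemma measurable_trace (p : X) (A : set (trace_space p)) :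
  measurable A <-> exists2 B : set (n.-tuple R), measurable B &
    A = [set u : X | B (set_val u)].
Proof.
by split=> [[B mB <-]|[B mB ->]]; exists B => //; rewrite ?setTI.
Qed.

Lemma measurable_trace_fun {d : measure_display} {Omega : measurableType d}
    (p : X) (x : Omega -> X) :
  measurable_fun setT (fun w => set_val (x w)) ->
  measurable_fun setT (x : Omega -> trace_space p).
Proof. by move=> mx _ A /measurable_trace[B mB ->]; exact: mx. Qed.

Lemma measurable_classifierE {c : nat} (p : X) (h : X -> 'cV[R]_c) :
  measurable_classifier h <-> measurable_cols (h : trace_space p -> 'cV[R]_c).
Proof.
split=> mh j; first by move=> _ B mB; rewrite setTI; exact/measurable_trace/mh.
move=> B mB; apply/(measurable_trace p).
by rewrite -[X in measurable X]setTI; exact: mh.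
Qed.

End trace_space.

(** * Comparison of the two risks *)

Theorem theorem3 (R : realType) (d c m : nat) (T : finType)
    (X : set (d.-tuple R))
    (dO : measure_display) (Omega : measurableType dO) (P : probability Omega R)
    (x : Omega -> X) (y : Omega -> 'I_c)
    (iota : Omega -> 'I_m) (tau : Omega -> T)
    (x_meas : measurable_fun setT (fun w => set_val (x w)))
    (y_meas : discrete_rv y)
    (iota_meas : discrete_rv iota) (tau_meas : discrete_rv tau) :
  let ytilde := fun w => synthetic (iota w) (tau w) in
  let Q := prob_matrix P y ytilde in
  cond_indep_given P ytilde x y ->
  row_free Q ->
  argmin (risk_TL P Q x ytilde) = argmin (risk P x y) /\
  (forall hTL h : X -> 'cV[R]_c,
     argmin (risk_TL P Q x ytilde) hTL -> argmin (risk P x y) h ->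
     {ae P, forall w, softmax (hTL (x w)) = softmax (h (x w))}).
Proof.
move=> ytilde Q indep Qfree.
have mz : discrete_rv ytilde by exact: discrete_rv_synthetic.
have Py := row_free_class_neq0 P y ytilde ^~ Qfree.
(* [Omega] is pointed, so its image under [x] supplies the base point of [X]. *)
pose Y := trace_space (x point).
pose x' : {mfun Omega >-> Y} := HB.pack (x : Omega -> Y)
  (isMeasurableFun.Build _ _ _ _ _ (measurable_trace_fun (x point) x x_meas)).
have [f fP] := posterior_exists P x' y y_meas.
(* The description shared by both sets of minimisers; it mentions neither [Q] nor the synthetic
   label. *)
pose recovers (h : X -> 'cV[R]_c) :=
  measurable_classifier h /\
  ae_eq (distribution P x') setT (fun u : Y => softmax (h u)) f.
have argminE (r : (X -> 'cV[R]_c) -> \bar R) :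
    (forall h, measurable_cols (h : Y -> _) ->
      (forall h', measurable_cols (h' : Y -> _) -> (r h <= r h')%E) <->
      ae_eq (distribution P x') setT (fun u : Y => softmax (h u)) f) ->
    argmin r = [set h | recovers h].
  move=> rP; apply/seteqP; split=> h [mh hr]; split=> //.
    apply: (rP h ((measurable_classifierE _ h).1 mh)).1 => h'.
    by move=> /measurable_classifierE; exact: hr.
  move=> h' /(measurable_classifierE (x point)).
  exact: (rP h ((measurable_classifierE _ h).1 mh)).2 hr h'.
have TLE : argmin (risk_TL P Q x ytilde) = [set h | recovers h].
  apply: argminE.
  apply: (@channel_risk_minimizerP _ _ _ _ _ _ _ P x' y ytilde Q f fP) => //.
  - exact: prob_matrix_ge0.
  - by move=> j; exact: prob_matrix_row_sum.
  - move=> o A /measurable_trace[B mB ->].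
    exact: prob_matrix_cond_indep.
have riskE : argmin (risk P x y) = [set h | recovers h].
  have -> : risk P x y = risk_TL P 1%:M x y.
    by apply/funext => h; apply: eq_integral => w _; rewrite trmx1 mul1mx.
  apply: argminE.
  apply: (@channel_risk_minimizerP _ _ _ _ _ _ _ P x' y y 1%:M f fP) => //.
  - by move=> i j; rewrite mxE ler0n.
  - move=> j; rewrite (bigD1 j)//= mxE eqxx big1 ?addr0// => i ij.
    by rewrite mxE eq_sym (negbTE ij).
  - move=> i A mA; rewrite (bigD1 i)//= mxE eqxx mul1e big1 ?adde0// => j ij.
    by rewrite mxE (negbTE ij) mul0e.
  - by rewrite row_free_unit unitmx1.
split; first by rewrite TLE riskE.
move=> hTL h; rewrite TLE riskE => -[_ hTLf] [_ hf].
(* [N] is null for the law of [x], a pushforward of [P], so its preimage under [x] is null for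
   [P]. *)
have [N [mN N0 subN]] := ae_eq_trans hTLf (ae_eq_sym hf).
exists (x' @^-1` N); split=> //; first exact: measurable_funPTI.
by move=> w /= hw; apply: subN => /= /(_ I).
Qed.
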